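(* Let $f,g:\mathbb{R}^n\to\mathbb{R}^+$ be log-concave functions and $\lambda\in(0,1)$. Then \[ \int_{\mathbb{R}^n}\Delta_\lambda^{f,g}\;\int_{\mathbb{R}^n} f^{\lambda}g^{1-\lambda}\le \int_{\mathbb{R}^n}f\int_{\mathbb{R}^n}g. \]
   Context: For $\lambda\in(0,1)$ and $f,g:\mathbb{R}^n\to\mathbb{R}^+$, the $\lambda$-difference function $\Delta_\lambda^{f,g}:\mathbb{R}^n\to\mathbb{R}^+$ is defined by \[ \Delta_\lambda^{f,g}(z)=\sup_{(1-\lambda)x+\lambda y=z} f^{1-\lambda}\!\left(\tfrac{x}{1-\lambda}\right)g^{\lambda}\!\left(\tfrac{-y}{\lambda}\right). \] A function $f\ge0$ is log-concave if $f=e^{-\varphi}$ for a convex $\varphi:\mathbb{R}^n\to\mathbb{R}\cup\{+\infty\}$. *)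

(* Defs.v *)
From HB Require Import structures.
From mathcomp Require Import all_boot all_order all_algebra.
From mathcomp Require Import all_classical all_reals all_analysis.
Set Implicit Arguments. Unset Strict Implicit. Unset Printing Implicit Defensive.
Import Order.TTheory GRing.Theory Num.Theory.
Local Open Scope classical_set_scope.
Local Open Scope ring_scope.

Section defs.
Variable R : realType.

(* Lebesgue integral over R^n = 'rV[R]_n of a [0,+oo]-valued function,
   realized as the iterated one-dimensional Lebesgue integral
   (first coordinate outermost). *)
Fixpoint integral_Rn (n : nat) : ('rV[R]_n -> \bar R) -> \bar R :=
  match n with
  | 0 => fun F => F 0
  | m.+1 => fun F : 'rV[R]_m.+1 -> \bar R =>
      (\int[@lebesgue_measure R]_(t in [set: R])
         integral_Rn (fun v : 'rV[R]_m =>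
           F (row_mx (const_mx (t : R) : 'rV[R]_1) v : 'rV[R]_(1 + m))))%E
  end.

(* convexity of phi : R^n -> R \cup {+oo} (values in \bar R, never -oo) *)
Definition convex_ext n (phi : 'rV[R]_n -> \bar R) : Prop :=
  forall (x y : 'rV[R]_n) (t : R), 0 < t < 1 ->
    (phi ((1 - t) *: x + t *: y)%R <= (1 - t)%:E * phi x + t%:E * phi y)%E.

Definition log_concave n (f : 'rV[R]_n -> R) : Prop :=
  exists phi : 'rV[R]_n -> \bar R,
    [/\ forall x, phi x != -oo%E, convex_ext phi &
        forall x, (f x)%:E = expeR (- phi x)%E].

Definition lambda_diff n (l : R) (f g : 'rV[R]_n -> R) (z : 'rV[R]_n) : \bar R :=
  ereal_sup [set e : \bar R | exists x y : 'rV[R]_n,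
     (1 - l) *: x + l *: y = z /\
     e = ((f ((1 - l)^-1 *: x)) `^ (1 - l) * (g (- (l^-1 *: y))) `^ l)%:E].

End defs.

(* Main.v *)
(* Substituting a = x / (1 - l), b = - y / l, w = (v + y) / (1 - l),
   log-concavity bounds f(a)^(1-l) g(b)^l f(w)^l g(w)^(1-l) by
   f((z + l v) / (1 - l)) g(v) where z = (1 - l) x + l y.  Integrating in v, taking
   the supremum over (x, y), and then integrating in z gives the claim by Tonelli
   and an affine change of variables; all powers of 1 - l cancel.

   A log-concave function need not be Borel in dimension n >= 2, and the
   iterated integrals of the statement are lower integrals on non-measurable
   functions, so Tonelli cannot be applied to f and g directly.  When f >= c > 0
   on a box around x0 and f <= M, log-concavity gives, for t < 1,
   f(x) <= (M / c)^(1-t) f_((1 - t) x0 + t x), where f_ is a Borel minorant of f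
   (a supremum of multiples of indicators of countably many boxes).  Tonelli is
   applied to these majorants, and t -> 1.  If f or g is bounded below by a
   positive constant on no box, then f^l g^(1-l) has integral 0; if one of them
   is unbounded, its integral is infinite. *)
Require Import Defs.
From HB Require Import structures.
From mathcomp Require Import all_boot all_order all_algebra.
From mathcomp Require Import all_classical all_reals all_analysis.
From mathcomp Require Import measurable_realfun.
From mathcomp Require Import ring lra.
Set Implicit Arguments. Unset Strict Implicit. Unset Printing Implicit Defensive.
Import Order.TTheory GRing.Theory Num.Theory.
Local Open Scope classical_set_scope.
Local Open Scope ring_scope.

(** * Integrals of nonnegative functions without measurability *)

Section lower_integral.
Context d (T : measurableType d) (R : realType).
Variable mu : {measure set T -> \bar R}.
Implicit Types F G : T -> \bar R.
Local Open Scope ereal_scope.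
Import HBNNSimple.

Lemma ge0_integral_leP F (B : \bar R) : (forall x, 0 <= F x) ->
  (forall h : {nnsfun T >-> R}, (forall x, (h x)%:E <= F x) ->
     \int[mu]_x (h x)%:E <= B) ->
  \int[mu]_x F x <= B.
Proof.
move=> F0 FB; rewrite ge0_integralTE//; apply: ge_ereal_sup => _ [h /= hF <-].
by have := FB h hF; rewrite integral_nnsfun// patch_setT.
Qed.

(* No measurability is assumed here and in the next lemmas: on nonnegative
   functions the library's integral is the supremum over simple minorants. *)
Lemma ge0_le_integralT F G : (forall x, 0 <= F x) -> (forall x, F x <= G x) ->
  \int[mu]_x F x <= \int[mu]_x G x.
Proof.
move=> F0 FG; have G0 x : 0 <= G x by apply: le_trans (F0 x) (FG x).
apply: ge0_integral_leP => // h hF.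
rewrite (ge0_integralTE _ G0); apply: ereal_sup_ubound; exists h => /=.
  by move=> x; exact: le_trans (hF x) (FG x).
by rewrite integral_nnsfun// patch_setT.
Qed.

Lemma ge0_le_integralZl F (k : R) : (0 <= k)%R -> (forall x, 0 <= F x) ->
  k%:E * \int[mu]_x F x <= \int[mu]_x (k%:E * F x).
Proof.
rewrite le_eqVlt => /predU1P[<- F0|k0 F0].
  by rewrite mul0e; apply: integral_ge0 => x _; rewrite mul0e.
rewrite -lee_pdivlMl//; apply: ge0_integral_leP => // h hF.
rewrite lee_pdivlMl// -ge0_integralZl_EFin//; first last.
- exact: ltW.
- exact/measurable_EFinP.
- by move=> x _; rewrite lee_fin.
apply: ge0_le_integralT => x.
- by rewrite -EFinM lee_fin mulr_ge0// ltW.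
- by rewrite lee_pmul2l.
Qed.

Lemma ge0_integralTZl F (k : R) : (0 <= k)%R -> (forall x, 0 <= F x) ->
  \int[mu]_x (k%:E * F x) = k%:E * \int[mu]_x F x.
Proof.
rewrite le_eqVlt => /predU1P[<- F0|k0 F0].
  by rewrite mul0e; apply: integral0_eq => x _; rewrite mul0e.
apply/eqP; rewrite eq_le ge0_le_integralZl ?(ltW k0)// andbT.
have kF0 x : 0 <= k%:E * F x by rewrite mule_ge0// lee_fin ltW.
(* The reverse inequality is the same lemma for the factor [k^-1] and the function [k * F]. *)
have := @ge0_le_integralZl _ k^-1 _ kF0; rewrite invr_ge0 ltW// => /(_ isT).
rewrite lee_pdivrMl//; under [X in _ <= _ * X -> _]eq_integral => x _.
  rewrite muleA -EFinM mulVf ?gt_eqF// mul1e; over.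
by [].
Qed.

End lower_integral.

(** * Affine change of variables on the line *)

Section affine_1d.
Context {R : realType}.
Local Notation mu := (@lebesgue_measure R).
Local Open Scope ereal_scope.
Import HBNNSimple.

Let affine (a b : R) (t : measurableTypeR R) : measurableTypeR R :=
  (a * t + b)%R.

Let measurable_affine a b : measurable_fun setT (affine a b).
Proof. by apply: measurable_funD => //; exact: measurable_funM. Qed.

HB.instance Definition _ a b :=
  isMeasurableFun.Build _ _ _ _ (affine a b) (measurable_affine a b).

(** Uniqueness of Lebesgue measure: the scaled image measure gives every half-open interval its
    length. *)
Let lebesgue_measure_affine (a b : R) (A : set R) : (0 < a)%R ->
  measurable A -> mu A = a%:E * pushforward mu (affine a b) A.
Proof.
move=> a0; have a0' : (0 <= a)%R by exact: ltW.
have -> : a%:E * pushforward mu (affine a b) A =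
   mscale (NngNum a0') (pushforward mu (affine a b)) A by [].
apply: lebesgue_measure_unique => //= _ [[x y]] _ <-.
rewrite /mscale/= /pushforward/=.
have -> : affine a b @^-1` `]x, y]%classic =
    `]((x - b) / a)%R, ((y - b) / a)%R]%classic.
  apply/seteqP; split => t /=; rewrite !in_itv /=;
    by rewrite ltr_pdivrMr// ler_pdivlMr// ltrBlDr lerBrDr /affine mulrC.
rewrite !lebesgue_measure_itv/= !lte_fin ltr_pM2r ?invr_gt0// ltrD2r.
case: ifP => _; last by rewrite mule0.
by rewrite -!EFinB -EFinM; congr EFin; field; rewrite gt_eqF.
Qed.

(** A simple minorant [h] of [F] is measurable, so it can be transported exactly, and
    [h (a * x + b)] lies below [F (a * x + b)]. This direction suffices: the inverse map will give
    the other one. *)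
Lemma ge0_le_integral_affine (a b : R) (F : R -> \bar R) : (0 < a)%R ->
  (forall x, 0 <= F x) ->
  \int[mu]_x F x <= a%:E * \int[mu]_x F (a * x + b)%R.
Proof.
move=> a0 F0; have a0' : (0 <= a)%R by exact: ltW.
apply: ge0_integral_leP => // h hF.
have mh : measurable_fun setT (EFin \o h) by exact/measurable_EFinP.
rewrite (@eq_measure_integral _ _ _ _
    (mscale (NngNum a0') (pushforward mu (affine a b)))); last first.
  by move=> A mA _; exact: lebesgue_measure_affine.
rewrite ge0_integral_mscale//; last by move=> x _; rewrite lee_fin.
rewrite ge0_integral_pushforward//; last by move=> x _; rewrite lee_fin.
rewrite preimage_setT lee_pmul2l//; apply: ge0_le_integralT => x.
  by rewrite /= lee_fin.
exact: hF.
Qed.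

End affine_1d.

(** * The iterated integral: monotonicity, homogeneity, affine maps, boxes *)

Section integral_Rn.
Context {R : realType}.
Local Notation mu := (@lebesgue_measure R).
Local Open Scope ereal_scope.

Definition cons_row n (t : R) (v : 'rV[R]_n) : 'rV[R]_n.+1 :=
  row_mx (const_mx t : 'rV[R]_1) v.

Lemma integral_RnS n (F : 'rV[R]_n.+1 -> \bar R) :
  integral_Rn F = \int[mu]_t integral_Rn (fun v => F (cons_row t v)).
Proof. by []. Qed.

Lemma cons_row0 n (t : R) (v : 'rV[R]_n) : cons_row t v 0%R ord0 = t.
Proof.
transitivity ((row_mx (const_mx t : 'rV_1) v) ord0 (lshift n ord0)).
  by congr (row_mx _ _ _ _); exact: val_inj.
by rewrite row_mxEl mxE.
Qed.

Lemma cons_row_lift n (t : R) (v : 'rV[R]_n) (i : 'I_n) :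
  cons_row t v 0%R (lift ord0 i) = v 0%R i.
Proof.
transitivity ((row_mx (const_mx t : 'rV_1) v) ord0 (rshift 1 i)).
  by congr (row_mx _ _ _ _); exact: val_inj.
by rewrite row_mxEr. Qed.

Lemma cons_rowE n (x : 'rV[R]_n.+1) :
  x = cons_row (x 0%R ord0) (\row_i x 0%R (lift ord0 i)).
Proof.
apply/rowP => i; case: (unliftP ord0 i) => [j|] ->; last by rewrite cons_row0.
by rewrite cons_row_lift mxE.
Qed.

Lemma cons_rowZD n (a b s t : R) (v w : 'rV[R]_n) :
  (a *: cons_row s v + b *: cons_row t w =
   cons_row (a * s + b * t) (a *: v + b *: w))%R.
Proof.
have lincE m (A B : 'rV[R]_m) i :
  ((a *: A + b *: B) 0 i = a * A 0 i + b * B 0 i)%R by rewrite !mxE.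
apply/rowP => i; rewrite lincE; case: (unliftP ord0 i) => [j|] ->.
  by rewrite !cons_row_lift lincE.
by rewrite !cons_row0.
Qed.

Lemma integral_Rn_ge0 n (F : 'rV[R]_n -> \bar R) :
  (forall x, 0 <= F x) -> 0 <= integral_Rn F.
Proof.
elim: n F => [|n ih] F F0; [exact: F0|rewrite integral_RnS].
by apply: integral_ge0 => t _; apply: ih.
Qed.

Lemma le_integral_Rn n (F G : 'rV[R]_n -> \bar R) :
  (forall x, 0 <= F x) -> (forall x, F x <= G x) ->
  integral_Rn F <= integral_Rn G.
Proof.
elim: n F G => [|n ih] F G F0 FG; [exact: FG|rewrite !integral_RnS].
apply: ge0_le_integralT => t; last exact: ih.
exact: integral_Rn_ge0.
Qed.

Lemma integral_RnZl n (F : 'rV[R]_n -> \bar R) (k : R) : (0 <= k)%R ->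
  (forall x, 0 <= F x) ->
  integral_Rn (fun x => k%:E * F x) = k%:E * integral_Rn F.
Proof.
move=> k0; elim: n F => [|n ih] F F0 //; rewrite !integral_RnS.
rewrite -ge0_integralTZl//; last by move=> t; exact: integral_Rn_ge0.
by congr integral; apply/funext => t; rewrite ih.
Qed.

(** Induction on the dimension: each coordinate is substituted separately and contributes one factor
    [a]. *)
Lemma le_integral_Rn_affine n (F : 'rV[R]_n -> \bar R) (a : R) (b : 'rV[R]_n) :
  (0 < a)%R -> (forall x, 0 <= F x) ->
  integral_Rn F <= (a ^+ n)%:E * integral_Rn (fun x => F (a *: x + b)%R).
Proof.
move=> a0; elim: n F b => [|n ih] F b F0.
  by rewrite expr0 mul1e /= [X in _ <= F X](_ : _ = 0%R)//; apply/rowP; case.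
rewrite !integral_RnS.
set b' := (\row_i b 0%R (lift ord0 i))%R.
pose G t := integral_Rn (fun v => F (cons_row t (a *: v + b')%R)).
have G0 t : 0 <= G t by exact: integral_Rn_ge0.
apply: (@le_trans _ _ (\int[mu]_t ((a ^+ n)%:E * G t))).
  apply: ge0_le_integralT => t; first exact: integral_Rn_ge0.
  by apply: (ih (fun v => F (cons_row t v))).
rewrite ge0_integralTZl//; last by rewrite exprn_ge0// ltW.
rewrite exprSr EFinM -muleA lee_pmul2l ?lte_fin ?exprn_gt0//.
apply: le_trans (@ge0_le_integral_affine _ a (b 0%R ord0) _ a0 G0) _.
rewrite lee_pmul2l//; apply: ge0_le_integralT => // t.
rewrite /G; apply: le_integral_Rn => // v.
rewrite [X in _ <= F (_ + X)%R]cons_rowE -/b' -[X in _ <= F (_ + X)%R]scale1r.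
by rewrite cons_rowZD mul1r scale1r.
Qed.

(** The previous inequality, applied to the composed function and the inverse map
    [x |-> a^-1 *: x - a^-1 *: b]. *)
Lemma integral_Rn_comp_affine_le n (F : 'rV[R]_n -> \bar R) (a : R)
    (b : 'rV[R]_n) : (0 < a)%R -> (forall x, 0 <= F x) ->
  integral_Rn (fun x => F (a *: x + b)%R) <= (a^-1 ^+ n)%:E * integral_Rn F.
Proof.
move=> a0 F0; have aV0 : (0 < a^-1)%R by rewrite invr_gt0.
apply: le_trans (@le_integral_Rn_affine _ _ a^-1 (- (a^-1 *: b)) aV0 _) _.
  by move=> x; exact: F0.
rewrite lee_pmul2l ?lte_fin ?exprn_gt0//; apply: le_integral_Rn => // x.
by rewrite scalerDr scalerN !scalerA divff ?gt_eqF// !scale1r subrK.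
Qed.

Lemma le_box_integral_Rn n (F : 'rV[R]_n -> \bar R) (x0 : 'rV[R]_n) (r c : R) :
  (0 < r)%R -> (0 <= c)%R -> (forall x, 0 <= F x) ->
  (forall x : 'rV[R]_n, (forall i, `|x 0%R i - x0 0%R i| < r)%R ->
     c%:E <= F x) ->
  (c * r ^+ n)%:E <= integral_Rn F.
Proof.
move=> r0 c0; elim: n F x0 => [|n ih] F x0 F0 cF.
  by rewrite expr0 mulr1; apply: cF; case.
rewrite integral_RnS.
(* Only the upper half of each side of the box is used, whence [r ^+ n] and not [(2 * r) ^+ n]. *)
set A := `](x0 0 ord0)%R, (x0 0 ord0 + r)%R[%classic.
apply: (@le_trans _ _ (\int[mu]_t ((c * r ^+ n)%:E * (\1_A t)%:E))).
  rewrite ge0_integralTZl//; last by rewrite mulr_ge0// exprn_ge0// ltW.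
  rewrite integral_indic//; last exact: measurable_itv.
  rewrite setIT /A /= lebesgue_measure_itv/= lte_fin ltrDl r0.
  by rewrite -EFinB addrC addKr -EFinM exprSr mulrA.
apply: ge0_le_integralT => t.
  by rewrite -EFinM lee_fin !mulr_ge0// exprn_ge0// ltW.
rewrite indicE; have [|_] := boolP (t \in A); last first.
  by rewrite mule0; exact: integral_Rn_ge0.
rewrite inE /A /= in_itv /= mule1 => /andP[t1 t2].
apply: (ih _ (\row_i x0 0%R (lift ord0 i))) => [//|v vr].
apply: cF => i; case: (unliftP ord0 i) => [j|] ->.
  by have := vr j; rewrite cons_row_lift mxE.
by rewrite cons_row0 ltr_norml; lra.
Qed.

End integral_Rn.

(** * Measurability on R^n and Tonelli's theorem for iterated integrals *)

Section tonelli_Rn.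
Context {R : realType}.
Local Notation mu := (@lebesgue_measure R).
Local Open Scope ereal_scope.

(* 'rV[R]_n carries no sigma-algebra in the library; measurability of maps from
   and to it is tested on coordinates and by composition with such maps. *)
Definition measurable_row d (U : measurableType d) n (x : U -> 'rV[R]_n) :=
  forall i, measurable_fun setT (fun u => x u 0%R i).

Lemma measurable_cons_row d (U : measurableType d) n (t : U -> R)
    (x : U -> 'rV[R]_n) :
  measurable_fun setT t -> measurable_row x ->
  measurable_row (fun u => cons_row (t u) (x u)).
Proof.
move=> mt mx i; case: (unliftP ord0 i) => [j|] ->.
  by under eq_fun do rewrite cons_row_lift; exact: mx.
by under eq_fun do rewrite cons_row0.
Qed.

Lemma measurable_row_comp d (U : measurableType d) d' (V : measurableType d') n
    (x : U -> 'rV[R]_n) (p : V -> U) :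
  measurable_fun setT p -> measurable_row x -> measurable_row (x \o p).
Proof. by move=> mp mx i; exact: (measurableT_comp (mx i) mp). Qed.

Definition measurable_Rn n (F : 'rV[R]_n -> \bar R) :=
  forall d (U : measurableType d) (x : U -> 'rV[R]_n),
    measurable_row x -> measurable_fun setT (F \o x).

Definition measurable_Rn2 d (T : measurableType d) n
    (F : T -> 'rV[R]_n -> \bar R) :=
  forall d' (U : measurableType d') (p : U -> T) (x : U -> 'rV[R]_n),
    measurable_fun setT p -> measurable_row x ->
    measurable_fun setT (fun u => F (p u) (x u)).

(** The parameter space is arbitrary so that the induction can move the first coordinate into it,
    passing from [T] to [T * R]; one-dimensional Tonelli then integrates that coordinate out. *)
Lemma measurable_integral_Rn d (T : measurableType d) n
    (F : T -> 'rV[R]_n -> \bar R) :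
  (forall p x, 0 <= F p x) -> measurable_Rn2 F ->
  measurable_fun setT (fun p => integral_Rn (F p)).
Proof.
elim: n d T F => [|n ih] d T F F0 mF.
  have m0 : measurable_row (fun _ : T => 0%R : 'rV[R]_0) by case.
  exact: (mF _ T idfun _ (@measurable_id _ _ _) m0).
pose G (pt : T * R) := integral_Rn (fun v => F pt.1 (cons_row pt.2 v)).
have mG : measurable_fun setT G.
  apply: (ih _ (T * R)%type (fun pt v => F pt.1 (cons_row pt.2 v))) => //.
  move=> d' U p x mp mx; apply: (mF _ U (fst \o p)).
    exact: measurableT_comp.
  by apply: measurable_cons_row => //; exact: measurableT_comp.
have G0 x : 0 <= G x by exact: integral_Rn_ge0.
exact: (@measurable_fun_fubini_tonelli_F _ _ T _ R mu G mG G0).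
Qed.

Lemma integral_integral_Rn n (F : R -> 'rV[R]_n -> \bar R) :
  (forall s x, 0 <= F s x) -> measurable_Rn2 F ->
  \int[mu]_s integral_Rn (F s) = integral_Rn (fun v => \int[mu]_s F s v).
Proof.
elim: n F => [//|n ih] F F0 mF; rewrite integral_RnS.
pose G (st : R * R) := integral_Rn (fun v => F st.1 (cons_row st.2 v)).
have mG : measurable_fun setT G.
  apply: (@measurable_integral_Rn _ (R * R)%type _
    (fun st v => F st.1 (cons_row st.2 v))) => //.
  move=> d U p x mp mx; apply: (mF _ U (fst \o p)).
    exact: measurableT_comp.
  by apply: measurable_cons_row => //; exact: measurableT_comp.
have G0 x : 0 <= G x by exact: integral_Rn_ge0.
transitivity (\int[mu]_t \int[mu]_s G (s, t)).
  by rewrite -(@fubini_tonelli _ _ _ _ _ mu mu G mG G0).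
congr integral; apply/funext => t.
apply: (ih (fun s v => F s (cons_row t v))) => // d U p x mp mx.
apply: mF => //; apply: measurable_cons_row => //; exact: measurable_cst.
Qed.

(** The coordinates of [z] are moved past the whole of [v] one at a time, by induction on [m]. *)
Lemma integral_Rn_swap m n (F : 'rV[R]_m -> 'rV[R]_n -> \bar R) :
  (forall z v, 0 <= F z v) ->
  (forall d (U : measurableType d) (z : U -> 'rV[R]_m) (v : U -> 'rV[R]_n),
     measurable_row z -> measurable_row v ->
     measurable_fun setT (fun u => F (z u) (v u))) ->
  integral_Rn (fun z => integral_Rn (F z)) =
  integral_Rn (fun v => integral_Rn (F ^~ v)).
Proof.
elim: m F => [//|m ih] F F0 mF; rewrite integral_RnS.
pose G s v := integral_Rn (fun z => F (cons_row s z) v).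
transitivity (\int[mu]_s integral_Rn (G s)).
  congr integral; apply/funext => s.
  apply: (ih (fun z v => F (cons_row s z) v)) => // d U z v mz mv.
  apply: mF => //; apply: measurable_cons_row => //; exact: measurable_cst.
rewrite integral_integral_Rn//.
  by move=> s v; exact: integral_Rn_ge0.
move=> d U p x mp mx.
apply: (measurable_integral_Rn (F := fun u z => F (cons_row (p u) z) (x u))) => //.
move=> d' V q z mq mz; apply: mF; last exact: measurable_row_comp.
by apply: measurable_cons_row => //; exact: measurableT_comp.
Qed.

End tonelli_Rn.

(** * The Borel minorant built from countably many rational boxes *)

Section lsc_minorant.
Context {R : realType} {n : nat}.
Variable f : 'rV[R]_n -> R.

Definition rat_box (k : nat) (q : 'rV[rat]_n) (x : 'rV[R]_n) : bool :=
  [forall i, `|x 0 i - ratr (q 0 i)| < k.+1%:R^-1].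

Definition rat_box_inf (kq : nat * 'rV[rat]_n) (x : 'rV[R]_n) : \bar R :=
  if rat_box kq.1 kq.2 x then
    ereal_inf [set (f y)%:E | y in [set y | rat_box kq.1 kq.2 y]]
  else 0%E.

(* [esups _ 0] is the supremum of the whole sequence. *)
Definition lsc_minorant (x : 'rV[R]_n) : \bar R :=
  esups (fun j => oapp (rat_box_inf ^~ x) 0%E (unpickle j)) 0%N.

(** A countable supremum of multiples of indicators, each box being a finite intersection of
    conditions on single coordinates. *)
Lemma measurable_lsc_minorant : measurable_Rn lsc_minorant.
Proof.
move=> d U x mx.
pose h j u := oapp (rat_box_inf ^~ (x u)) 0%E (unpickle j).
apply: (@measurable_fun_esups _ U R setT h) => j; rewrite /h.
case: unpickle => [[k q]|] /=; last exact: measurable_cst.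
apply: measurable_fun_ifT; [|exact: measurable_cst|exact: measurable_cst].
apply: (measurable_fun_bool true); rewrite setTI.
rewrite (_ : _ @^-1` _ = \bigcap_(i in [set: 'I_n])
    [set u | `|x u 0 i - ratr (q 0 i)| < k.+1%:R^-1]); last first.
  apply/seteqP; split=> u /=.
    by move=> /forallP H i _; exact: H.
  by move=> H; apply/forallP => i; exact: H.
apply: fin_bigcap_measurable => [|i _]; first exact: finite_finset.
have : measurable_fun setT (fun u => `|x u 0 i - ratr (q 0 i)| < k.+1%:R^-1).
  apply: measurable_fun_ltr => //; apply: measurableT_comp => //.
  exact: measurable_funB.
by move=> /(_ measurableT [set true]); rewrite setTI; exact.
Qed.

Lemma le_lsc_minorant (kq : nat * 'rV[rat]_n) x :
  (rat_box_inf kq x <= lsc_minorant x)%E.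
Proof.
by apply: ereal_sup_ubound; exists (pickle kq) => //=; rewrite pickleK.
Qed.

Hypothesis f0 : forall x, 0 <= f x.

Lemma lsc_minorant_ge0 x : (0 <= lsc_minorant x)%E.
Proof.
apply: le_trans (le_lsc_minorant (0%N, 0) x); rewrite /rat_box_inf.
by case: ifP => // _; apply: le_ereal_inf_tmp => _ [y _ <-]; rewrite lee_fin.
Qed.

Lemma lsc_minorant_le x : (lsc_minorant x <= (f x)%:E)%E.
Proof.
apply: ge_ereal_sup => _ [j _ <-]; case: unpickle => [kq|] /=; last first.
  by rewrite lee_fin.
rewrite /rat_box_inf; case: ifP => [xkq|_]; last by rewrite lee_fin.
by apply: ereal_inf_lbound; exists x.
Qed.

Lemma lsc_minorant_ge_box (x : 'rV[R]_n) (r c : R) : 0 < r ->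
  (forall y : 'rV[R]_n, (forall i, `|y 0 i - x 0 i| < r) -> c <= f y) ->
  (c%:E <= lsc_minorant x)%E.
Proof.
(* A rational box of radius below [r / 2] that contains [x] lies within distance [r] of [x], so the
   infimum of [f] over it is at least [c]. *)
move=> r0 cf; have [k kr] : exists k : nat, k.+1%:R^-1 *+ 2 < r.
  exists (Num.truncn (2 / r)).
  by rewrite -[_ *+ 2]mulr_natl ltr_pdivrMr// mulrC -ltr_pdivrMr// truncnS_gt.
have k0 : 0 < k.+1%:R^-1 :> R by [].
have [q qx] : exists q : 'I_n -> rat,
    forall i, `|x 0 i - ratr (q i)| < k.+1%:R^-1.
  apply: (@fin_all_exists _ (fun=> rat)
    (fun i q => `|x 0 i - ratr q| < k.+1%:R^-1)) => i.
  have [|q] := @rat_in_itvoo _ (x 0 i) (x 0 i + k.+1%:R^-1).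
    by rewrite ltrDl.
  rewrite in_itv/= => /andP[q1 q2]; exists q; rewrite ltr_norml.
  by move: (k.+1%:R^-1) (ratr q : R) k0 q1 q2 => e p *; apply/andP; split; lra.
apply: le_trans (le_lsc_minorant (k, \row_i q i) x); rewrite /rat_box_inf /=.
rewrite ifT; last by apply/forallP => i; rewrite mxE.
apply: le_ereal_inf_tmp => _ [y /forallP yq <-]; rewrite lee_fin.
apply: cf => i; apply: le_lt_trans kr.
rewrite mulr2n -(subrKA (ratr (q i))) (le_trans (ler_normD _ _))//.
have := yq i; rewrite mxE => /ltW; have := qx i; rewrite distrC => /ltW.
by move=> a b; exact: lerD.
Qed.

End lsc_minorant.

(** * Boxes on which a quasi-concave function is bounded below *)

Section quasi_concave.
Context {R : realType}.
Local Notation mu := (@lebesgue_measure R).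

Definition quasi_concave n (f : 'rV[R]_n -> R) := forall x y (t : R),
  0 < t < 1 -> Num.min (f x) (f y) <= f ((1 - t) *: x + t *: y).

(** A function that is nonzero at no more than one point has integral 0, since points are null
    sets. *)
Lemma integral_neq0_two_points (F : R -> \bar R) : (\int[mu]_t F t != 0)%E ->
  exists t0 t1, [/\ t0 < t1, F t0 != 0%E & F t1 != 0%E].
Proof.
move=> F0; apply: contrapT => noF; move/eqP: F0; apply.
have [[t0 Ft0]|Fz] := pselect (exists t, F t != 0%E); last first.
  apply: integral0_eq => t _; apply: contrapT => /eqP Ft; by apply: Fz; exists t.
transitivity (\int[mu]_(t in [set t0]) F t)%E; last exact: integral_set1.
rewrite [RHS]integral_mkcond; congr integral; apply/funext => t; rewrite patchE.
case: ifPn => //; rewrite notin_setE => /eqP tt0.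
apply: contrapT => /eqP Ft; apply: noF.
by move: tt0; rewrite neq_lt => /orP[]; [exists t, t0|exists t0, t].
Qed.

(* Two fibres of nonzero integral contain boxes by induction, and the convex
   hull of these contains a box around its centre. *)
Lemma quasi_concave_box n (f : 'rV[R]_n -> R) (h : 'rV[R]_n -> \bar R) :
  quasi_concave f -> (forall x, 0 <= f x) ->
  (forall x, f x = 0 -> h x = 0%E) ->
  integral_Rn h != 0%E ->
  exists x0 : 'rV[R]_n, exists r c, [/\ 0 < r, 0 < c &
    forall x : 'rV[R]_n, (forall i, `|x 0 i - x0 0 i| < r) -> c <= f x].
Proof.
elim: n f h => [|n ih] f h qf f0 fh.
  move=> /= h0; exists 0, 1, (f 0); split => //.
    rewrite lt_neqAle f0 andbT; apply: contra_neq h0 => ?; exact: fh.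
  by move=> x _; rewrite [x](_ : _ = 0)//; apply/rowP; case.
rewrite integral_RnS => /integral_neq0_two_points[t0 [t1 [t01 h0 h1]]].
have qf' t : quasi_concave (fun v => f (cons_row t v)).
  move=> x y s s01.
  apply: le_trans (qf (cons_row t x) (cons_row t y) s s01) _.
  by rewrite cons_rowZD -mulrDl subrK mul1r.
have {h0} [x0 [r0 [c0 [r0_gt0 c0_gt0 f_c0]]]] := ih (fun v => f (cons_row t0 v))
  (fun v => h (cons_row t0 v)) (qf' t0) (fun=> f0 _) (fun=> fh _) h0.
have {h1} [x1 [r1 [c1 [r1_gt0 c1_gt0 f_c1]]]] := ih (fun v => f (cons_row t1 v))
  (fun v => h (cons_row t1 v)) (qf' t1) (fun=> f0 _) (fun=> fh _) h1.
pose r := Num.min r0 r1; pose d := t1 - t0.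
have d_gt0 : 0 < d by rewrite subr_gt0.
pose L := \sum_i `|x1 0 i - x0 0 i|.
have L_ge0 : 0 <= L by exact: sumr_ge0.
have leL i : `|x1 0 i - x0 0 i| <= L.
  by rewrite /L (bigD1 i)//= lerDl sumr_ge0.
(* The bound [d / 2] keeps the weight [s] below strictly between 0 and 1. The other one gives
   [rho + rho / d * L <= r], which bounds the shift [e]. *)
pose rho := Num.min (d / 2) (r / (1 + L / d)).
have den_gt0 : 0 < 1 + L / d by rewrite ltr_pwDl// divr_ge0// ltW.
have r_gt0 : 0 < r by rewrite lt_min r0_gt0.
have rho_gt0 : 0 < rho by rewrite lt_min !divr_gt0.
have rho_d : rho <= d / 2 by rewrite ge_min lexx.
have rho_r : rho * (1 + L / d) <= r.
  by rewrite -ler_pdivlMr// ge_min lexx orbT.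
exists (cons_row (2^-1 * (t0 + t1)) (2^-1 *: (x0 + x1))), rho, (Num.min c0 c1).
split => //; first by rewrite lt_min c0_gt0.
move=> x xrho.
rewrite (cons_rowE x) in xrho *.
move: (x 0 ord0) (\row_i _) xrho => t y {x} xrho.
have trho : `|t - 2^-1 * (t0 + t1)| < rho.
  by have := xrho ord0; rewrite !cons_row0.
have yrho i : `|y 0 i - 2^-1 * (x0 0 i + x1 0 i)| < rho.
  by have := xrho (lift ord0 i); rewrite !cons_row_lift !mxE.
pose s := (t - t0) / d; have sd : s * d = t - t0 by rewrite divfK ?gt_eqF.
have s_near : `|s - 2^-1| <= rho / d.
  rewrite ler_pdivlMr// -[X in _ * X](gtr0_norm d_gt0) -normrM mulrBl sd.
  by rewrite (_ : _ - _ = t - 2^-1 * (t0 + t1)) ?ltW// /d; lra.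
have s01 : 0 < s < 1.
  rewrite divr_gt0 ?ltr_pdivrMr//= ?mul1r /d; move: trho; rewrite ltr_norml;
    by move: rho_d; rewrite /d; lra.
have tE : t = (1 - s) * t0 + s * t1.
  by move: sd; rewrite /d mulrBr mulrBl; lra.
(* The point lies on a segment joining the two fibres, with weight [s]. Shifting both box centres by
   the same [e] makes the segment pass through it, and [e] is small enough to stay in both boxes. *)
pose e := y - ((1 - s) *: x0 + s *: x1).
have er i : `|e 0 i| < r.
  apply: lt_le_trans rho_r.
  have -> : e 0 i = (y 0 i - 2^-1 * (x0 0 i + x1 0 i)) -
      (s - 2^-1) * (x1 0 i - x0 0 i) by rewrite !mxE; lra.
  apply: le_lt_trans (ler_normB _ _) _; rewrite [ltRHS]mulrDr mulr1 ltr_leD// normrM.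
  by rewrite [leRHS]mulrCA [leRHS]mulrC ler_pM.
have -> : cons_row t y =
    (1 - s) *: cons_row t0 (x0 + e) + s *: cons_row t1 (x1 + e).
  rewrite cons_rowZD -tE; congr cons_row; apply/rowP => i; rewrite !mxE; ring.
have near_e v ri : r <= ri -> forall i, `|(v + e) 0 i - v 0 i| < ri.
  move=> rri i; rewrite [(v + e) 0 i]mxE addrAC subrr add0r.
  exact: lt_le_trans (er i) rri.
apply: le_trans (qf _ _ _ s01); rewrite le_min !ge_min.
by rewrite f_c0 ?f_c1 ?orbT//; apply: near_e; rewrite ge_min lexx ?orbT.
Qed.

End quasi_concave.

(** * Consequences of log-concavity *)

Section log_concave_functions.
Context {R : realType} {n : nat}.
Implicit Type f : 'rV[R]_n -> R.

Lemma log_concave_ge0 f x : log_concave f -> 0 <= f x.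
Proof.
by move=> [phi [_ _ fE]]; rewrite -lee_fin fE expeR_ge0.
Qed.

Lemma log_concave_le f x y (t : R) : log_concave f -> 0 < t < 1 ->
  f x `^ (1 - t) * f y `^ t <= f ((1 - t) *: x + t *: y).
Proof.
move=> fl t01; case/andP: (t01) => t0 t1; have f0 := log_concave_ge0 _ fl.
(* Zeros of [f], where [phi] is infinite, are treated apart; the power vanishes there because its
   exponent is nonzero. *)
have [-> | fx0] := eqVneq (f x) 0.
  by rewrite powR0 ?mul0r ?f0// subr_eq0 gt_eqF.
have [-> | fy0] := eqVneq (f y) 0.
  by rewrite powR0 ?mulr0 ?f0// gt_eqF.
case: fl => phi [phiNy phi_conv fE].
have finphi z : f z != 0 -> exists2 r, phi z = r%:E & f z = expR (- r).
  move=> fz; have := fE z; have := phiNy z; case: (phi z) => [r _ [->]||//].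
    by exists r.
  by move=> _ /= [fz0]; rewrite fz0 eqxx in fz.
have [a phia ->] := finphi _ fx0; have [b phib ->] := finphi _ fy0.
rewrite -!expRM -expRD -lee_fin fE.
have := phi_conv x y t t01; rewrite phia phib -!EFinM -EFinD.
have := phiNy ((1 - t) *: x + t *: y).
case: (phi _) => [r _||//] //=; rewrite !lee_fin ler_expR; lra.
Qed.

Lemma log_concave_quasi_concave f : log_concave f -> quasi_concave f.
Proof.
move=> fl x y t t01; apply: le_trans (log_concave_le x y fl t01).
case/andP: (t01) => t0 t1; have f0 := log_concave_ge0 _ fl.
set m := Num.min _ _; have m0 : 0 <= m by rewrite le_min !f0.
have -> : m = m `^ (1 - t) * m `^ t.
  by rewrite -powRD ?subrK ?powRr1// oner_eq0.
have [t_ge0 t'_ge0] : 0 <= t /\ 0 <= 1 - t by split; lra.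
by rewrite ler_pM ?powR_ge0// ge0_ler_powR ?nnegrE// ge_min lexx ?orbT.
Qed.

(** Every [y] within [(1 - t) * r] of the dilated point is [(1 - t) *: a + t *: x] with [a] in the
    box around [x0]. Hence f(y) >= c^(1-t) f(x)^t >= (c / M)^(1-t) f(x), a bound on a whole box,
    which the minorant inherits. *)
Lemma le_lsc_minorant_dilation f (x0 : 'rV[R]_n) (r c M t : R) x :
  log_concave f -> 0 < r -> 0 < c ->
  (forall x : 'rV[R]_n, (forall i, `|x 0 i - x0 0 i| < r) -> c <= f x) ->
  (forall x, f x <= M) -> 0 < t < 1 ->
  ((f x)%:E <=
   ((M / c) `^ (1 - t))%:E * lsc_minorant f ((1 - t) *: x0 + t *: x)%R)%E.
Proof.
move=> fl r0 c0 fc fM t01; case/andP: (t01) => t0 t1.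
have f0 := log_concave_ge0 _ fl.
have M0 : 0 < M.
  by apply: lt_le_trans (fM x0); apply: lt_le_trans (fc _ _) => // i; rewrite subrr normr0.
have K0 : 0 < (M / c) `^ (1 - t) by rewrite powR_gt0// divr_gt0.
rewrite -lee_pdivrMl// -EFinM.
have t'0 : 0 < 1 - t by rewrite subr_gt0.
have [c_ge0 M_ge0 t_ge0 t'_ge0] := And4 (ltW c0) (ltW M0) (ltW t0) (ltW t'0).
apply: (@lsc_minorant_ge_box _ _ f _ ((1 - t) * r)); first exact: mulr_gt0.
move=> y yr; pose a := (1 - t)^-1 *: (y - t *: x).
have -> : y = (1 - t) *: a + t *: x.
  by rewrite scalerA divff ?gt_eqF// scale1r subrK.
apply: le_trans (log_concave_le a x fl t01).
have ca : c <= f a.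
  apply: fc => i; rewrite -(ltr_pM2l t'0) -[X in X * `|_|](gtr0_norm t'0).
  apply: le_lt_trans (yr i); rewrite -normrM le_eqVlt; apply/orP; left.
  by apply/eqP; congr `|_|; rewrite !mxE; field; rewrite gt_eqF.
rewrite ler_pdivrMl//.
apply: (@le_trans _ _ ((M / c) `^ (1 - t) * (c `^ (1 - t) * f x `^ t))).
  rewrite mulrA -powRM ?divr_ge0// divfK ?gt_eqF//.
  have [->|fx0] := eqVneq (f x) 0; first by rewrite mulr_ge0// powR_ge0.
  rewrite -{1}(@powRr1 _ (f x))// -[X in _ `^ X <= _](subrK t 1) powRD; last by rewrite fx0 implybT.
  by rewrite ler_pM2r ?powR_gt0 ?lt_def ?fx0 ?f0// ge0_ler_powR ?nnegrE ?f0.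
by rewrite ler_pM2l// ler_wpM2r ?powR_ge0// ge0_ler_powR// nnegrE.
Qed.

(** Halfway between the box and a point [x] with a large value lies a box of half the size on which
    [f] is at least the square root of [c * f x]. *)
Lemma log_concave_unbounded f (x0 : 'rV[R]_n) (r c : R) :
  log_concave f -> 0 < r -> 0 < c ->
  (forall x : 'rV[R]_n, (forall i, `|x 0 i - x0 0 i| < r) -> c <= f x) ->
  ~ (exists M, forall x, f x <= M) ->
  integral_Rn (EFin \o f) = +oo%E.
Proof.
move=> fl r0 c0 fc fM; apply/eqyP => A A0.
have f0 := log_concave_ge0 _ fl.
pose k := c `^ 2^-1 * (r / 2) ^+ n.
have k0 : 0 < k by rewrite mulr_gt0 ?powR_gt0// exprn_gt0// divr_gt0.
(* This threshold makes the resulting lower bound c^(1/2) (A / k) (r / 2)^n equal to [A]. *)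
have [x fx] : exists x, (A / k) ^+ 2 < f x.
  apply: contrapT => fA; apply: fM; exists ((A / k) ^+ 2) => x.
  by rewrite leNgt; apply/negP => fx; apply: fA; exists x.
have Ak_ge0 : 0 <= A / k by rewrite divr_ge0// ltW.
have half01 : 0 < (2^-1 : R) < 1 by lra.
have r20 : 0 < r / 2 by rewrite divr_gt0.
apply: (@le_trans _ _ (c `^ 2^-1 * (A / k) * (r / 2) ^+ n)%:E).
  by rewrite lee_fin mulrAC -/k mulrC divfK// gt_eqF.
apply: (@le_box_integral_Rn R n _ ((1 - 2^-1) *: x0 + 2^-1 *: x)) => //.
  by rewrite mulr_ge0 ?powR_ge0.
move=> y yr; rewrite /=  lee_fin; pose a := 2 *: y - x.
have -> : y = (1 - 2^-1) *: a + 2^-1 *: x.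
  by apply/rowP => i; rewrite !mxE; lra.
apply: le_trans (log_concave_le a x fl half01).
have h1 : (1 - 2^-1 : R) = 2^-1 by lra.
rewrite h1 ler_pM ?powR_ge0//.
- rewrite ge0_ler_powR ?nnegrE ?(ltW c0)//; apply: fc => i.
  have := yr i; rewrite !mxE !ltr_norml; lra.
- have -> : A / k = ((A / k) ^+ 2) `^ 2^-1.
    by rewrite powR12_sqrt ?sqr_ge0// sqrtr_sqr ger0_norm.
  by rewrite ge0_ler_powR ?nnegrE ?sqr_ge0// ltW.
Qed.

End log_concave_functions.

(** * The pointwise inequality and its integration *)

Section assembly.
Context {R : realType}.

(** For [y = +oo], letting [k] grow forces [B = +oo] unless [x = 0]. It lets homogeneity of the
    integral, stated for real factors, serve when the integral of f^l g^(1-l) is infinite. *)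
Lemma lee_mul_of_fin_le (x y B : \bar R) : (0 <= x)%E -> (0 <= y)%E ->
  (forall k : R, 0 <= k -> (k%:E <= y)%E -> (k%:E * x <= B)%E) ->
  (x * y <= B)%E.
Proof.
move=> x0 y0 kB; case: y y0 kB => [k k0 kB|_ kB|//].
  by rewrite muleC; apply: kB => //; rewrite -lee_fin.
move: x0; rewrite le_eqVlt => /predU1P[<-|x_gt0].
  by rewrite mul0e; have := kB 0 (lexx _) (leey _); rewrite mul0e.
suff -> : B = +oo%E by rewrite leey.
apply/eqyP => A A0; case: x x_gt0 kB => [r|_ kB|//].
  rewrite lte_fin => r0 kB; have := kB (A / r) (divr_ge0 (ltW A0) (ltW r0)) (leey _).
  by rewrite -EFinM divfK ?gt_eqF.
have := kB 1 ler01 (leey _); rewrite mul1e; exact: le_trans (leey _).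
Qed.

Variable n : nat.
Implicit Types f g : 'rV[R]_n -> R.

(* With a = x / (1 - l) and b = - y / l, the points on the right-hand side are
   (1 - l) a + l w and l b + (1 - l) w. *)
Lemma log_concave_mul_le f g (l : R) x y v (w := (1 - l)^-1 *: (v + y)) :
  log_concave f -> log_concave g -> 0 < l < 1 ->
  (f ((1 - l)^-1 *: x)) `^ (1 - l) * (g (- (l^-1 *: y))) `^ l *
    (f w `^ l * g w `^ (1 - l)) <=
  f ((1 - l)^-1 *: ((1 - l) *: x + l *: y + l *: v)) * g v.
Proof.
move=> fl gl l01; case/andP: (l01) => l0 l1.
have l'01 : 0 < 1 - l < 1 by apply/andP; split; lra.
have lNZ : l != 0 by rewrite gt_eqF.
have l'NZ : 1 - l != 0 by rewrite gt_eqF//; lra.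
rewrite mulrACA ler_pM ?mulr_ge0 ?powR_ge0//.
- apply: le_trans (log_concave_le _ _ fl l01) _.
  rewrite le_eqVlt; apply/orP; left; apply/eqP; congr f.
  by apply/rowP => i; rewrite !mxE; field.
- have := log_concave_le (- (l^-1 *: y)) w gl l'01; rewrite subKr => h.
  apply: le_trans h _; rewrite le_eqVlt; apply/orP; left; apply/eqP; congr g.
  by apply/rowP => i; rewrite !mxE; field; apply/andP.
Qed.

Let Phi f g (l : R) (z : 'rV[R]_n) : \bar R :=
  integral_Rn (fun v => (f ((1 - l)^-1 *: (z + l *: v)) * g v)%:E).

(** For fixed [x] and [y], the substitution w = (v + y) / (1 - l) costs (1 - l)^(-n), and the
    pointwise inequality applies under the integral. The bound depends on [x] and [y] only through
    [z], so it survives the supremum. *)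
Lemma lambda_diff_mul_le f g (l k : R) z :
  log_concave f -> log_concave g -> 0 < l < 1 -> 0 <= k ->
  (k%:E <= integral_Rn (fun x => ((f x) `^ l * (g x) `^ (1 - l))%:E))%E ->
  (k%:E * lambda_diff l f g z <= ((1 - l)^-1 ^+ n)%:E * Phi f g l z)%E.
Proof.
move=> fl gl l01 k0 kC; case/andP: (l01) => l0 l1.
have a0 : 0 < (1 - l)^-1 by rewrite invr_gt0 subr_gt0.
have [f0 g0] := (fun x => log_concave_ge0 x fl, fun x => log_concave_ge0 x gl).
have Phi0 : (0 <= ((1 - l)^-1 ^+ n)%:E * Phi f g l z)%E.
  rewrite mule_ge0 ?lee_fin ?exprn_ge0 ?(ltW a0)//.
  by apply: integral_Rn_ge0 => v; rewrite lee_fin mulr_ge0.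
move: k0; rewrite le_eqVlt => /predU1P[<-|k_gt0]; first by rewrite mul0e.
rewrite -lee_pdivlMl//; apply: ge_ereal_sup => _ [x [y [<- ->]]].
rewrite lee_pdivlMl// muleC.
set E := _ * _ `^ l; have E0 : 0 <= E by rewrite mulr_ge0// powR_ge0.
apply: (@le_trans _ _ (E%:E * integral_Rn (fun x => ((f x) `^ l * (g x) `^ (1 - l))%:E)))%E.
  by rewrite lee_wpmul2l.
have h0 w : (0 <= ((f w) `^ l * (g w) `^ (1 - l))%:E)%E.
  by rewrite lee_fin mulr_ge0// powR_ge0.
apply: (@le_trans _ _ (E%:E * _))%E.
  apply: lee_wpmul2l; first by rewrite lee_fin.
  exact: (@le_integral_Rn_affine _ _ _ _ ((1 - l)^-1 *: y) a0 h0).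
rewrite muleCA lee_wpmul2l ?lee_fin ?exprn_ge0 ?(ltW a0)//.
rewrite -integral_RnZl//; apply: le_integral_Rn => v.
  by rewrite mule_ge0// lee_fin.
by rewrite -EFinM lee_fin -scalerDr; exact: log_concave_mul_le.
Qed.

Lemma integral_lambda_diff_mul_le f g (l : R) :
  log_concave f -> log_concave g -> 0 < l < 1 ->
  (integral_Rn (lambda_diff l f g) *
   integral_Rn (fun x => ((f x) `^ l * (g x) `^ (1 - l))%:E)
   <= ((1 - l)^-1 ^+ n)%:E * integral_Rn (Phi f g l))%E.
Proof.
move=> fl gl l01; case/andP: (l01) => l0 l1.
have a0 : 0 < (1 - l)^-1 by rewrite invr_gt0 subr_gt0.
have D0 z : (0 <= lambda_diff l f g z)%E.
  apply: (@le_trans _ _ ((f ((1 - l)^-1 *: ((1 - l)^-1 *: z))) `^ (1 - l) *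
    (g (- (l^-1 *: 0))) `^ l)%:E).
    by rewrite lee_fin mulr_ge0// powR_ge0.
  (* The supremum runs over a nonempty set: x = z / (1 - l), y = 0 is admissible. *)
  apply: ereal_sup_ubound; exists ((1 - l)^-1 *: z), 0; split => //.
  by rewrite scaler0 addr0 scalerA divff ?scale1r// gt_eqF// subr_gt0.
have P0 z : (0 <= Phi f g l z)%E.
  apply: integral_Rn_ge0 => v.
  by rewrite lee_fin mulr_ge0// log_concave_ge0.
apply: lee_mul_of_fin_le.
- exact: integral_Rn_ge0.
- by apply: integral_Rn_ge0 => x; rewrite lee_fin mulr_ge0// powR_ge0.
move=> k k0 kC; rewrite -!integral_RnZl ?exprn_ge0 ?(ltW a0)//.
apply: le_integral_Rn => z; first by rewrite mule_ge0.
exact: lambda_diff_mul_le.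
Qed.

Lemma measurable_row_comb d (U : measurableType d) (a b : R) (x y : U -> 'rV[R]_n) :
  measurable_row x -> measurable_row y ->
  measurable_row (fun u => a *: x u + b *: y u).
Proof.
move=> mx my i.
rewrite (_ : (fun u => _) = (fun u => a * x u 0 i + b * y u 0 i)); last first.
  by apply/funext => u; rewrite !mxE.
by apply: measurable_funD; exact: measurable_funM.
Qed.

(** After Tonelli, [z] is integrated first with [v] fixed; then [z |-> a *: z + b *: v] is an affine
    map of ratio [a]. *)
Lemma integral_Rn_shear (F : 'rV[R]_n -> \bar R) (G : 'rV[R]_n -> \bar R)
    (a b : R) : 0 < a -> (forall x, 0 <= F x)%E ->
  (forall x, 0 <= G x)%E -> (forall x, G x < +oo)%E -> (integral_Rn F < +oo)%E ->
  measurable_Rn F -> measurable_Rn G ->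
  (integral_Rn (fun z => integral_Rn (fun v => F (a *: z + b *: v)%R * G v))
   <= (a^-1 ^+ n)%:E * (integral_Rn F * integral_Rn G))%E.
Proof.
move=> a0 F0 G0 Gfin IFfin mF mG.
have FG0 (x y : 'rV[R]_n) : (0 <= F x * G y)%E by rewrite mule_ge0.
rewrite integral_Rn_swap//; last first.
  move=> d U z v mz mv; apply: emeasurable_funM; last exact: mG.
  by apply: mF; exact: measurable_row_comb.
have IF0 := integral_Rn_ge0 F0.
have IFE : integral_Rn F = (fine (integral_Rn F))%:E by rewrite fineK// ge0_fin_numE.
rewrite muleA [in leRHS]IFE -EFinM -integral_RnZl//; last first.
  by rewrite mulr_ge0 ?fine_ge0// exprn_ge0// invr_ge0 ltW.
apply: le_integral_Rn => v; first exact: integral_Rn_ge0.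
have GE : G v = (fine (G v))%:E by rewrite fineK// ge0_fin_numE.
rewrite (_ : (fun z => _) = (fun z => (fine (G v))%:E * F (a *: z + b *: v)%R))%E; last first.
  by apply/funext => z; rewrite -GE muleC.
rewrite integral_RnZl ?fine_ge0// -GE muleC EFinM -IFE lee_wpmul2r//.
exact: integral_Rn_comp_affine_le.
Qed.

Lemma lsc_minorant_lty f x : (forall x, 0 <= f x) -> (lsc_minorant f x < +oo)%E.
Proof. by move=> f0; apply: le_lt_trans (lsc_minorant_le f0 x) (ltry _). Qed.

End assembly.

(** * Measurable majorants with almost the same integral *)

Section majorant.
Import numFieldNormedType.Exports.
Context {R : realType} {n : nat}.
Implicit Types f g : 'rV[R]_n -> R.

Lemma log_concave_majorant f (x0 : 'rV[R]_n) (r c M : R) :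
  log_concave f -> 0 < r -> 0 < c ->
  (forall x : 'rV[R]_n, (forall i, `|x 0 i - x0 0 i| < r) -> c <= f x) ->
  (forall x, f x <= M) ->
  exists D, forall s, 0 < s -> exists F : 'rV[R]_n -> \bar R,
    [/\ measurable_Rn F, forall x, (F x < +oo)%E, forall x, ((f x)%:E <= F x)%E &
        (integral_Rn F <= (expR (D * s))%:E * integral_Rn (EFin \o f))%E].
Proof.
move=> fl r0 c0 fc fM; have f0 x := log_concave_ge0 x fl.
have cM : c <= M.
  by apply: le_trans (fM x0); apply: fc => i; rewrite subrr normr0.
have Mc0 : 0 < M / c by rewrite divr_gt0// (lt_le_trans c0).
have lnMc : 0 <= ln (M / c) by rewrite ln_ge0// ler_pdivlMr// mul1r.
(* With t = e^(-s), the two losses are (M / c)^(1-t) <= e^(s ln(M / c)), as 1 - t <= s, and t^(-n) =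
   e^(n s) from the dilation. *)
exists (ln (M / c) + n%:R) => s s0; pose t := expR (- s).
have t0 : 0 < t by exact: expR_gt0.
have t1 : t < 1 by rewrite expR_lt1 oppr_lt0.
have t01 : 0 < t < 1 by rewrite t0.
pose F x := (((M / c) `^ (1 - t))%:E *
  lsc_minorant f ((1 - t) *: x0 + t *: x)%R)%E.
have m0 x := lsc_minorant_ge0 f0 x.
exists F; split.
- move=> d U x mx; apply: emeasurable_funM; first exact: measurable_cst.
  apply: (@measurable_lsc_minorant _ _ f _ U (fun u => (1 - t) *: x0 + t *: x u)).
  apply: (@measurable_row_comb _ _ _ U _ _ (fun=> x0) x) => //.
- move=> x; rewrite lte_mul_pinfty ?lee_fin ?powR_ge0//.
  exact: lsc_minorant_lty.
- by move=> x; exact: le_lsc_minorant_dilation fc _ _.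
rewrite /F integral_RnZl ?powR_ge0//.
have -> : (fun x => lsc_minorant f ((1 - t) *: x0 + t *: x)) =
    (fun x => lsc_minorant f (t *: x + (1 - t) *: x0)).
  by apply/funext => x; rewrite addrC.
have : (integral_Rn (lsc_minorant f) <= integral_Rn (EFin \o f))%E.
  by apply: le_integral_Rn => // x; exact: lsc_minorant_le.
move=> /(lee_wpmul2l _) le_f.
apply: le_trans (_ : ((M / c) `^ (1 - t))%:E * ((t^-1 ^+ n)%:E *
  integral_Rn (lsc_minorant f)) <= _)%E.
  apply: lee_wpmul2l; first by rewrite lee_fin powR_ge0.
  exact: integral_Rn_comp_affine_le.
rewrite muleA -EFinM.
have If0 : (0 <= integral_Rn (lsc_minorant f))%E by exact: integral_Rn_ge0.
apply: le_trans (le_f _ _); last by rewrite lee_fin expR_ge0.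
rewrite lee_wpmul2r// lee_fin mulrDl expRD ler_pM ?powR_ge0 ?exprn_ge0 ?invr_ge0 ?(ltW t0)//.
- rewrite /powR gt_eqF// ler_expR mulrC ler_wpM2l//.
  by have := expR_ge1Dx (- s); rewrite /t; lra.
- by rewrite /t -expRN opprK mulrC -expRM_natr.
Qed.

(** The bound is continuous in [s] and tends to [P] as [s] decreases to 0. *)
Lemma lee_expR_lim (X : \bar R) (D P : R) :
  (forall s, 0 < s -> (X <= (expR (D * s) * P)%:E)%E) -> (X <= P%:E)%E.
Proof.
case: X => [x|/(_ 1 ltr01)//|_]; last by rewrite leNye.
move=> xP; rewrite lee_fin.
apply: (@cvgr_to_ge _ (0 : R)^'+ _ _ (fun s => expR (D * s) * P)).
  rewrite -[X in _ --> X]mul1r -expR0 -[in X in _ --> X](mulr0 D).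
  apply: cvg_at_right_filter; apply: cvgM; last exact: cvg_cst.
  apply: (@continuous_cvg _ _ _ _ _ _ expR); first exact: continuous_expR.
  by apply: cvgM; [exact: cvg_cst|exact: cvg_id].
near=> s; rewrite -lee_fin; apply: xP; near: s; exact: nbhs_right_gt.
Unshelve. all: by end_near. Qed.

Lemma integral_Rn_gt0_of_box f (x0 : 'rV[R]_n) (r c : R) :
  (forall x, 0 <= f x) -> 0 < r -> 0 < c ->
  (forall x : 'rV[R]_n, (forall i, `|x 0 i - x0 0 i| < r) -> c <= f x) ->
  (0 < integral_Rn (EFin \o f))%E.
Proof.
move=> f0 r0 c0 fc.
apply: (@lt_le_trans _ _ (c * r ^+ n)%:E).
  by rewrite lte_fin mulr_gt0// exprn_gt0.
apply: (le_box_integral_Rn r0 (ltW c0)) => [x|x /fc]; by rewrite lee_fin.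
Qed.

End majorant.

(** * The inequality: degenerate cases, then majorants and the limit *)

Unset Implicit Arguments.

Theorem theorem1p8 (R : realType) (n : nat) (f g : 'rV[R]_n -> R) (l : R) :
  log_concave f -> log_concave g -> 0 < l < 1 ->
  (integral_Rn (lambda_diff l f g) *
   integral_Rn (fun x => ((f x) `^ l * (g x) `^ (1 - l))%:E)
   <= integral_Rn (fun x => (f x)%:E) * integral_Rn (fun x => (g x)%:E))%E.
Proof.
move=> fl gl l01; case/andP: (l01) => l0 l1.
have f0 x := log_concave_ge0 x fl; have g0 x := log_concave_ge0 x gl.
have If0 : (0 <= integral_Rn (EFin \o f))%E.
  by apply: integral_Rn_ge0 => x; rewrite lee_fin.
have Ig0 : (0 <= integral_Rn (EFin \o g))%E.
  by apply: integral_Rn_ge0 => x; rewrite lee_fin.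
set h := (X in (_ * integral_Rn X)%E).
have [->|h_neq0] := eqVneq (integral_Rn h) 0%E; first by rewrite mule0 mule_ge0.
have [x0 [r [c [r0 c0 fc]]]] : exists x0 : 'rV[R]_n, exists r c, [/\ 0 < r, 0 < c &
    forall x : 'rV[R]_n, (forall i, `|x 0 i - x0 0 i| < r) -> c <= f x].
  apply: quasi_concave_box h_neq0 => // [|x fx].
    exact: log_concave_quasi_concave.
  by rewrite /h fx powR0 ?mul0r// gt_eqF.
have [y0 [r' [c' [r'0 c'0 gc]]]] : exists x0 : 'rV[R]_n, exists r c, [/\ 0 < r, 0 < c &
    forall x : 'rV[R]_n, (forall i, `|x 0 i - x0 0 i| < r) -> c <= g x].
  apply: quasi_concave_box h_neq0 => // [|x gx].
    exact: log_concave_quasi_concave.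
  by rewrite /h gx powR0 ?mulr0// subr_eq0 gt_eqF.
have If_gt0 := integral_Rn_gt0_of_box f0 r0 c0 fc.
have Ig_gt0 := integral_Rn_gt0_of_box g0 r'0 c'0 gc.
have [Ify|Iff] := eqVneq (integral_Rn (EFin \o f)) +oo%E.
  by rewrite [X in (_ <= X * _)%E]Ify gt0_mulye ?leey.
have [Igy|Igf] := eqVneq (integral_Rn (EFin \o g)) +oo%E.
  by rewrite [X in (_ <= _ * X)%E]Igy gt0_muley ?leey.
have [M fM] : exists M, forall x, f x <= M.
  apply: contrapT => /(log_concave_unbounded fl r0 c0 fc); exact/eqP.
have [M' gM] : exists M, forall x, g x <= M.
  apply: contrapT => /(log_concave_unbounded gl r'0 c'0 gc); exact/eqP.
have [D fD] := log_concave_majorant fl r0 c0 fc fM.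
have [D' gD] := log_concave_majorant gl r'0 c'0 gc gM.
have IfE : integral_Rn (EFin \o f) = (fine (integral_Rn (EFin \o f)))%:E.
  by rewrite fineK// ge0_fin_numE// ltey.
have IgE : integral_Rn (EFin \o g) = (fine (integral_Rn (EFin \o g)))%:E.
  by rewrite fineK// ge0_fin_numE// ltey.
rewrite [X in (_ <= X * _)%E]IfE [X in (_ <= _ * X)%E]IgE -EFinM.
apply: (@lee_expR_lim _ _ (D + D')) => s s0.
have [F [mF Foo fF IF]] := fD _ s0; have [G [mG Goo gG IG]] := gD _ s0.
have F0 x : (0 <= F x)%E by apply: le_trans (fF x); rewrite lee_fin.
have G0 x : (0 <= G x)%E by apply: le_trans (gG x); rewrite lee_fin.
have a0 : 0 < (1 - l)^-1 by rewrite invr_gt0 subr_gt0.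
apply: le_trans (integral_lambda_diff_mul_le fl gl l01) _.
(* The first factor comes from the substitution in [v], the second from the shear of ratio
   [(1 - l)^-1]; they cancel. *)
apply: (@le_trans _ _ (((1 - l)^-1 ^+ n)%:E * (((1 - l)^-1^-1 ^+ n)%:E *
    (integral_Rn F * integral_Rn G)))%E).
  apply: lee_wpmul2l; first by rewrite lee_fin exprn_ge0// ltW.
  apply: le_trans (integral_Rn_shear ((1 - l)^-1 * l) a0 F0 G0 Goo _ mF mG).
    apply: le_integral_Rn => z.
      by apply: integral_Rn_ge0 => v; rewrite lee_fin mulr_ge0.
    apply: le_integral_Rn => v; first by rewrite lee_fin mulr_ge0.
    by rewrite EFinM scalerDr scalerA lee_pmul// lee_fin.
  by apply: le_lt_trans IF _; rewrite IfE -EFinM ltry.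
rewrite muleA -EFinM -exprMn divff ?gt_eqF// expr1n mul1e.
rewrite mulrDl expRD mulrACA EFinM [X in (_ <= X * _)%E]EFinM.
rewrite [X in (_ <= _ * X)%E]EFinM -IfE -IgE lee_pmul//; exact: integral_Rn_ge0.
Qed.
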